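(* Let $[\delta,\pi]$ be a non-comonotonic cloud defined on a finite set $X$. Let $0=\gamma_0<\ldots<\gamma_j<\ldots<\gamma_M=1$ be the distinct values taken by $\delta,\pi$ on elements of $X$. For $j=1,\ldots,M$, define the random set with focal elements $E_j$ and masses $m(E_j)$ given by $$E_j=\{x\in X\mid(\pi(x)\ge\gamma_j)\wedge(\delta(x)<\gamma_j)\},\qquad m(E_j)=\gamma_j-\gamma_{j-1}.$$ This random set is an inner approximation of $[\delta,\pi]$, in the sense that its credal set $\mathcal{P}_{Bel}$ satisfies $\mathcal{P}_{Bel}\subseteq\mathcal{P}_{[\delta,\pi]}$.
   Context: $X$ is a finite set and $\mathbb{P}_X$ is the set of probability measures on $X$. A cloud $[\delta,\pi]$ on $X$ is a pair of mappings $\delta,\pi:X\to[0,1]$ with $\delta\le\pi$ pointwise, $\pi(x)=1$ for at least one $x\in X$, and $\delta(y)=0$ for at least one $y\in X$. Its credal set is $$\mathcal{P}_{[\delta,\pi]}=\{P\in\mathbb{P}_X \mid \forall \alpha\in[0,1],\ P(\{x\in X\mid \delta(x)\ge\alpha\})\le 1-\alpha\le P(\{x\in X\mid \pi(x)>\alpha\})\}.$$ The cloud is comonotonic if for all $x,y\in X$, $\delta(x)<\delta(y)\Rightarrow\pi(x)\le\pi(y)$, and non-comonotonic otherwise. A random set on $X$ is a non-negative mass assignment $m$ on subsets of $X$ with $\sum_{E\subseteq X}m(E)=1$ and $m(\emptyset)=0$; subsets of positive mass are its focal elements. Its belief function is $Bel(A)=\sum_{E\subseteq A}m(E)$, where if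 the same set arises as $E_j$ for several indices $j$ the corresponding masses are added. Its credal set is $\mathcal{P}_{Bel}=\{P\in\mathbb{P}_X\mid\forall A\subseteq X,\ Bel(A)\le P(A)\}$.
   Formalization: That m is a random set is claimed only when all E_j are nonempty (some E_j can be empty, e.g. E_M when δ=π=1 at the only x with π(x)=1, and then m(∅)>0); the inclusion of credal sets is proved for all such clouds, with Bel summing over all E⊆A including ∅. *)

(* Defs.v *)
From mathcomp Require Import all_boot all_order all_algebra.
From mathcomp Require Import reals.

Set Implicit Arguments.
Unset Strict Implicit.
Unset Printing Implicit Defensive.

Import Order.TTheory GRing.Theory Num.Theory.
Local Open Scope ring_scope.

Section Clouds.
Variables (R : realType) (X : finType).

Implicit Types (P m : {set X} -> R) (delta pi : X -> R) (gamma : nat -> R).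

Definition is_prob P : Prop :=
  [/\ forall A, 0 <= P A,
      P [set: X] = 1 &
      forall A B : {set X}, [disjoint A & B] -> P (A :|: B) = P A + P B].

Definition is_cloud delta pi : Prop :=
  [/\ forall x, 0 <= delta x <= 1,
      forall x, 0 <= pi x <= 1,
      forall x, delta x <= pi x,
      exists x, pi x = 1 &
      exists y, delta y = 0].

Definition comonotonic delta pi : Prop :=
  forall x y, delta x < delta y -> pi x <= pi y.

Definition cloud_credal delta pi P : Prop :=
  is_prob P /\
  forall alpha : R, 0 <= alpha <= 1 ->
    P [set x | alpha <= delta x] <= 1 - alpha <= P [set x | alpha < pi x].

Definition is_random_set m : Prop :=
  [/\ forall E, 0 <= m E, \sum_(E : {set X}) m E = 1 & m set0 = 0].

(* The sum includes E = set0.  This changes nothing when m is a random set;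
   when m set0 > 0, it makes bel_credal m empty. *)
Definition Bel m (A : {set X}) : R := \sum_(E : {set X} | E \subset A) m E.

Definition bel_credal m P : Prop :=
  is_prob P /\ forall A : {set X}, Bel m A <= P A.

(* gamma 0 < ... < gamma M enumerates the union of the ranges of delta and pi;
   the values gamma j for j > M are irrelevant. *)
Definition is_value_enum delta pi (M : nat) gamma : Prop :=
  [/\ gamma 0%N = 0,
      gamma M = 1,
      forall i j, (i < j <= M)%N -> gamma i < gamma j &
      forall r : R, (exists2 j, (j <= M)%N & gamma j = r) <->
                    (exists x, delta x = r \/ pi x = r)].

Definition focal delta pi gamma (j : nat) : {set X} :=
  [set x | (gamma j <= pi x) && (delta x < gamma j)].

(* Distinct indices may yield the same set; their masses are then added. *)
Definition inner_mass delta pi (M : nat) gamma (E : {set X}) : R :=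
  \sum_(1 <= j < M.+1 | focal delta pi gamma j == E) (gamma j - gamma j.-1).

End Clouds.

(* Main.v *)
Require Import Defs.
From mathcomp Require Import all_boot all_order all_algebra.
From mathcomp Require Import reals.
From mathcomp Require Import lra.

Set Implicit Arguments.
Unset Strict Implicit.
Unset Printing Implicit Defensive.

Import Order.TTheory GRing.Theory Num.Theory.
Local Open Scope ring_scope.

(** The belief of a set [A] is the total length of the steps
    [gamma j.-1, gamma j] whose focal set lies in [A], so a lower bound on
    [Bel A] follows from any family of steps whose focal sets lie in [A].

    For [A = {pi > alpha}] the steps with [gamma j > alpha] qualify, since
    [pi >= gamma j] on the [j]-th focal set; they cover [alpha, 1], so
    [P A >= Bel A >= 1 - alpha].

    For [A = {delta < alpha}] the steps with [gamma j.-1 < alpha] qualify: on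
    the [j]-th focal set [delta < gamma j], and as [delta] takes no value
    strictly between consecutive levels, [delta <= gamma j.-1 < alpha].  These
    steps cover [0, alpha], so [P A >= alpha], and passing to the complement
    gives [P {delta >= alpha} <= 1 - alpha].

    The masses add up to [1] because the steps telescope from [0] to [1], and
    the empty set carries no mass when no focal set is empty. *)

Section Steps.
Variables (R : realDomainType) (gamma : nat -> R).

(** The steps ending above [a] cover everything from [a] to [gamma n], the one
    straddling [a] being counted in full. *)
Lemma sum_steps_above n (a : R) :
  (forall j, (j < n)%N -> gamma j <= gamma j.+1) -> gamma 0%N <= a ->
  gamma n - a <= \sum_(1 <= j < n.+1 | a < gamma j) (gamma j - gamma j.-1).
Proof.
move=> + g0; elim: n => [|n IHn] Hmono; first by rewrite big_nil subr_le0.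
have {}IHn := IHn (fun j Hj => Hmono j (ltnW Hj)).
case: (ltP a (gamma n.+1)) => Ha.
  by rewrite big_mkcond big_nat_recr //= -big_mkcond Ha; lra.
apply: (@le_trans _ _ 0); first by rewrite subr_le0.
rewrite big_nat_cond; apply: sumr_ge0 => -[|j] /andP[] // /andP[_ Hj] _.
by rewrite subr_ge0; apply: Hmono.
Qed.

Lemma sum_steps_below n (a : R) :
  (forall j, (j < n)%N -> gamma j <= gamma j.+1) -> gamma 0%N = 0 ->
  a <= gamma n ->
  a <= \sum_(1 <= j < n.+1 | gamma j.-1 < a) (gamma j - gamma j.-1).
Proof.
move=> Hmono g0 Ha.
(* The bound by the minimum is what survives induction: it stops growing once
   the sequence has passed [a]. *)
suff: forall k, (k <= n)%N ->
    Num.min (gamma k) a <=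
      \sum_(1 <= j < k.+1 | gamma j.-1 < a) (gamma j - gamma j.-1).
  by move=> /(_ n (leqnn n)); rewrite min_r.
elim=> [|k IHk] Hk; first by rewrite big_nil g0 ge_min lexx.
have {}IHk := IHk (ltnW Hk).
rewrite big_mkcond big_nat_recr //= -big_mkcond ge_min.
case: ltP IHk => Hka IHk; first by apply/orP; left; lra.
by rewrite addr0 IHk orbT.
Qed.

End Steps.

Section InnerRandomSet.
Variables (R : realType) (X : finType) (delta pi : X -> R).
Variables (M : nat) (gamma : nat -> R).
Hypothesis Hgamma : is_value_enum delta pi M gamma.

Lemma value_enum_step j : (j < M)%N -> gamma j <= gamma j.+1.
Proof.
by move=> Hj; case: Hgamma => _ _ Hlt _; apply/ltW/Hlt; rewrite ltnSn.
Qed.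

Lemma inner_step_ge0 j : (1 <= j < M.+1)%N -> 0 <= gamma j - gamma j.-1.
Proof. by case: j => // j Hj; rewrite subr_ge0 value_enum_step. Qed.

(** Every value of [delta] is a level, so none lies strictly between two
    consecutive ones. *)
Lemma delta_lt_level j x :
  (j < M)%N -> delta x < gamma j.+1 -> delta x <= gamma j.
Proof.
case: Hgamma => _ _ Hlt Hval Hj.
have [i Hi <-] := (Hval (delta x)).2 (ex_intro _ x (or_introl erefl)).
case: (ltngtP i j) => [Hij _|Hji|-> //].
  by apply/ltW/Hlt; rewrite Hij ltnW.
rewrite ltNge => /negP[]; move: Hji; rewrite leq_eqVlt => /predU1P[-> //|Hji].
by apply/ltW/Hlt; rewrite Hji.
Qed.

(** Each index contributes its step to the mass of exactly one set, so the two
    summations can be exchanged. *)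
Lemma Bel_inner_mass (A : {set X}) :
  Bel (inner_mass delta pi M gamma) A =
  \sum_(1 <= j < M.+1 | focal delta pi gamma j \subset A)
     (gamma j - gamma j.-1).
Proof.
rewrite /Bel /inner_mass.
rewrite (exchange_big_dep (fun j => focal delta pi gamma j \subset A)) /=.
  apply: eq_bigr => j Hj.
  rewrite (eq_bigl (pred1 (focal delta pi gamma j))) ?big_pred1_eq // => E /=.
  by rewrite eq_sym; case: eqP => [->|]; rewrite ?Hj ?andbF.
by move=> E j HE /eqP ->.
Qed.

(** Both bounds below come from this one: the index family [Q] is chosen so that
    its steps are easy to sum. *)
Lemma sum_steps_le_Bel (Q : pred nat) (A : {set X}) :
  (forall j, (1 <= j < M.+1)%N -> Q j -> focal delta pi gamma j \subset A) ->
  \sum_(1 <= j < M.+1 | Q j) (gamma j - gamma j.-1) <=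
  Bel (inner_mass delta pi M gamma) A.
Proof.
move=> HQ; rewrite Bel_inner_mass big_mkcond [leRHS]big_mkcond.
apply: ler_sum_nat => j Hj; case: ifP => [/(HQ j Hj) -> //|_].
by case: ifP => // _; apply: inner_step_ge0.
Qed.

Lemma Bel_pi_gt (a : R) : 0 <= a ->
  1 - a <= Bel (inner_mass delta pi M gamma) [set x | a < pi x].
Proof.
move=> a0; case: (Hgamma) => g0 gM _ _.
apply: (le_trans _ (@sum_steps_le_Bel (fun j => a < gamma j) _ _)).
  rewrite -gM; apply: sum_steps_above; first exact: value_enum_step.
  by rewrite g0.
move=> j _ Hj; apply/subsetP => x; rewrite !inE => /andP[Hpi _].
exact: lt_le_trans Hpi.
Qed.

Lemma Bel_delta_lt (a : R) : a <= 1 ->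
  a <= Bel (inner_mass delta pi M gamma) [set x | delta x < a].
Proof.
move=> a1; case: (Hgamma) => g0 gM _ _.
(* The steps that end below [a] need not cover [0, a]; the step straddling [a]
   has to be included, hence the condition on the lower end. *)
apply: (le_trans _ (@sum_steps_le_Bel (fun j => gamma j.-1 < a) _ _)).
  apply: sum_steps_below => //; first exact: value_enum_step.
  by rewrite gM.
case=> // j Hj /= Ha; apply/subsetP => x; rewrite !inE => /andP[_ Hd].
exact: le_lt_trans (delta_lt_level Hj Hd) Ha.
Qed.

Lemma inner_mass_random_set :
  (forall j, (1 <= j <= M)%N -> focal delta pi gamma j != set0) ->
  is_random_set (inner_mass delta pi M gamma).
Proof.
move=> Hne; case: (Hgamma) => g0 gM _ _; split.
- move=> E; rewrite /inner_mass big_nat_cond; apply: sumr_ge0 => j.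
  by case/andP=> Hj _; apply: inner_step_ge0.
- have := Bel_inner_mass [set: X]; rewrite /Bel.
  rewrite (eq_bigl xpredT) => [->|E]; last by rewrite subsetT.
  rewrite (eq_bigl xpredT) => [|j]; last by rewrite subsetT.
  by rewrite big_add1 /= telescope_sumr // gM g0 subr0.
- rewrite /inner_mass big_nat_cond big1 // => j /andP[Hj].
  by rewrite (negbTE (Hne j Hj)).
Qed.

End InnerRandomSet.

Lemma prob_setC (R : realType) (X : finType) (P : {set X} -> R) (A : {set X}) :
  is_prob P -> P A + P (~: A) = 1.
Proof.
case=> _ <- Hadd; rewrite -Hadd ?setUCr //.
by rewrite -setI_eq0 setICr.
Qed.

Theorem proposition5 (R : realType) (X : finType) (delta pi : X -> R)
    (M : nat) (gamma : nat -> R)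
    (Hcloud : is_cloud delta pi)
    (Hncom : ~ comonotonic delta pi)
    (Hgamma : is_value_enum delta pi M gamma) :
  ((forall j, (1 <= j <= M)%N -> focal delta pi gamma j != set0) ->
     is_random_set (inner_mass delta pi M gamma)) /\
  (forall P : {set X} -> R,
     bel_credal (inner_mass delta pi M gamma) P -> cloud_credal delta pi P).
Proof.
split; first exact: inner_mass_random_set.
move=> P [HP Hbel]; split=> // a /andP[a0 a1]; apply/andP; split.
  have := le_trans (Bel_delta_lt Hgamma a1) (Hbel _).
  have -> : [set x | delta x < a] = ~: [set x | a <= delta x].
    by apply/setP => x; rewrite !inE ltNge.
  by have := prob_setC [set x | a <= delta x] HP; lra.
exact: le_trans (Bel_pi_gt Hgamma a0) (Hbel _).
Qed.
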